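(* Let $\mathbf{f}=(\mathbf{f}^{(1)},\ldots,\mathbf{f}^{(n)}):\mathbb{R}^n\to\mathbb{R}^n$, let $\mathbf{x}^*$ be a solution of the nonlinear system $\mathbf{f}(\mathbf{x})=\mathbf{0}$, and suppose that $\mathbf{f}$ is continuously differentiable and that its second-order derivative exists. Let $\mathbf{M}_k\in\mathbb{R}^{n\times n}$ be non-singular matrices. Then the preconditioned fixed-point iteration $$\mathbf{x}_{k+1}=\mathbf{x}_k-\mathbf{M}_k^{-1}\mathbf{f}(\mathbf{x}_k)$$ converges if $$\left\|\mathbf{I}-\mathbf{M}_k^{-1}\mathcal{J}_k\right\|<1,$$ where $\mathcal{J}_k$ is the $n\times n$ Jacobian matrix of $\mathbf{f}$ at iteration $k$. Moreover, setting $\mathbf{e}_k=\mathbf{x}^*-\mathbf{x}_k$, the errors of any two consecutive iterates are related by $$\mathbf{e}_{k+1}=\left(\mathbf{I}-\mathbf{M}_k^{-1}\mathcal{J}_k\right)\mathbf{e}_k-\frac{1}{2}\mathbf{M}_k^{-1}\mathbf{q}_k+\mathcal{O}(\|\mathbf{e}_k\|^3),$$ where $\mathbf{q}_k\in\mathbb{R}^n$ is the vector whose $i$-th component is $\mathbf{e}_k^{\mathrm{T}}\mathbf{H}^{(i)}(\mathbf{x}_k)\,\mathbf{e}_k$, and $\mathbf{H}^{(i)}(\mathbf{x}_k)$ is the Hessian matrix of the $i$-th component function $\mathbf{f}^{(i)}$ at iteration $k$ ($i=1,\ldots,n$).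
   Context: The iteration generates a sequence $(\mathbf{x}_k)_{k\ge 0}$ in $\mathbb{R}^n$ from an initial guess $\mathbf{x}_0$. The matrices $\mathbf{M}_k$ (the preconditioners at iteration $k$) are non-singular real $n\times n$ matrices and may change with $k$. $\mathbf{I}$ is the $n\times n$ identity matrix. ''At iteration $k$'' means evaluated at $\mathbf{x}_k$, so $\mathcal{J}_k=\mathbf{f}'(\mathbf{x}_k)$. The condition $\|\mathbf{I}-\mathbf{M}_k^{-1}\mathcal{J}_k\|<1$ is imposed at the iterations $k$; the paper does not specify the norm. The vector $\mathbf{e}_k=\mathbf{x}^*-\mathbf{x}_k$ is called the local error, and $\mathcal{O}(\|\mathbf{e}_k\|^3)$ denotes a remainder term of third order in $\|\mathbf{e}_k\|$ for small $\|\mathbf{e}_k\|$.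
   Formalization: Convergence is shown for x_0 near x*, the Jacobian at x* nonsingular and the norms bounded by some ρ<1; the error relation assumes H(x)−H(x* )=O(‖x−x*‖), with constant proportional to ‖M_k^{-1}‖, or uniform if the Jacobian at x* is nonsingular and the norm is <1. *)

(* Defs.v *)
From HB Require Import structures.
From mathcomp Require Import all_boot all_order all_algebra.
From mathcomp Require Import all_classical all_reals all_analysis.
Set Implicit Arguments.
Unset Strict Implicit.
Unset Printing Implicit Defensive.
Import Order.TTheory GRing.Theory Num.Theory.
Import numFieldNormedType.Exports.
Local Open Scope classical_set_scope.
Local Open Scope ring_scope.

(* Nonnegativity follows from the three axioms. *)
Definition is_norm (R : realType) (V : lmodType R) (nu : V -> R) : Prop :=
  [/\ forall v, nu v = 0 -> v = 0,
      forall a v, nu (a *: v) = `|a| * nu v &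
      forall u v, nu (u + v) <= nu u + nu v].

(* Submultiplicativity holds for the operator norm induced by any vector norm
   and for the Frobenius norm; it excludes e.g. the largest-entry norm. *)
Definition is_matrix_norm (R : realType) (n : nat) (mu : 'M[R]_n -> R) : Prop :=
  is_norm mu /\ forall A B : 'M[R]_n, mu (A *m B) <= mu A * mu B.

Definition component (R : realType) (n : nat) (f : 'cV[R]_n -> 'cV[R]_n)
    (i : 'I_n) : 'cV[R]_n -> R :=
  fun x => f x i 0.

Definition partial (R : realType) (n : nat) (j : 'I_n) (g : 'cV[R]_n -> R) :
    'cV[R]_n -> R :=
  fun x => 'D_(delta_mx j 0) g x.

(* The library's 'J f acts on row vectors from the right; this is the usual
   Jacobian, acting on column vectors from the left. *)
Definition jacobian_mx (R : realType) (n : nat) (f : 'cV[R]_n -> 'cV[R]_n)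
    (x : 'cV[R]_n) : 'M[R]_n :=
  \matrix_(i, j) partial j (component f i) x.

Definition hessian_mx (R : realType) (n : nat) (g : 'cV[R]_n -> R)
    (x : 'cV[R]_n) : 'M[R]_n :=
  \matrix_(j, l) partial j (partial l g) x.

Definition hessian_forms (R : realType) (n : nat) (f : 'cV[R]_n -> 'cV[R]_n)
    (x e : 'cV[R]_n) : 'cV[R]_n :=
  \col_i (e^T *m hessian_mx (component f i) x *m e) 0 0.

Definition continuously_differentiable (R : realType) (n : nat)
    (f : 'cV[R]_n -> 'cV[R]_n) : Prop :=
  (forall x, differentiable f x) /\ continuous (jacobian_mx f).

Definition twice_differentiable (R : realType) (n : nat)
    (f : 'cV[R]_n -> 'cV[R]_n) : Prop :=
  (forall x, differentiable f x) /\
  (forall x, differentiable (jacobian_mx f) x).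

(* H(x) - H(a) = O(|x - a|) as x --> a, for the Hessian H of each component.
   It holds when the second derivative of f is Lipschitz near a, or
   differentiable at a.  Mere existence of the second derivative does not make
   the second-order Taylor remainder O(|x - a|^3): for f x = x + `|x|^(5/2)
   and a = 0 it is of exact order 5/2. *)
Definition hessians_lipschitz_at (R : realType) (n : nat)
    (f : 'cV[R]_n -> 'cV[R]_n) (a : 'cV[R]_n) : Prop :=
  forall i : 'I_n,
    (fun x => hessian_mx (component f i) x - hessian_mx (component f i) a)
      =O_a (fun x => x - a).

Definition preconditioned_iteration (R : realType) (n : nat)
    (f : 'cV[R]_n -> 'cV[R]_n) (M : nat -> 'M[R]_n) (x : nat -> 'cV[R]_n) :
    Prop :=
  forall k, x k.+1 = x k - invmx (M k) *m f (x k).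

(* Main.v *)
Require Import Defs.
From HB Require Import structures.
From mathcomp Require Import all_boot all_order all_algebra.
From mathcomp Require Import all_classical all_reals all_analysis.
From mathcomp Require Import ring lra.
Set Implicit Arguments.
Unset Strict Implicit.
Unset Printing Implicit Defensive.
Import Order.TTheory GRing.Theory Num.Theory.
Import numFieldNormedType.Exports.
Local Open Scope classical_set_scope.
Local Open Scope ring_scope.

(** Write [a] for the solution, [e = a - x] for the error, [J] for the Jacobian
at [x] and [B] for the inverse of the preconditioner.  Everything rests on the
identity [error_step]: one step turns [e] into [(1 - B J) e + B (f x + J e)].

Convergence.  As [f a = 0], the vector [f x + J e] is the error of the
linearization of [f] between [x] and [a], hence [o(e)] because [f] is
continuously differentiable ([linearization_error]).  The hypothesis
[mu (1 - B J) <= rho] also bounds [mu B] uniformly near [a]: the product [B J]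
is bounded and [J] is close to the invertible Jacobian at [a]
([invertible_factor_bound]).  So near [a] one step multiplies the norm of the
error by at most [(rho + 1) / 2 < 1] ([local_contraction]); the iterates stay
in the neighbourhood and converge geometrically ([contraction_cvg]).

Error expansion.  Restricting each component of [f] to the segment from [x] to
[a] and applying the mean value theorem twice bounds the second-order Taylor
remainder by the oscillation of the Hessian form on that segment
([component_taylor]).  The Lipschitz bound on the Hessians at [a] makes this
oscillation [O(|e|^3)] ([taylor_remainder_cubic]).  The remainder of the
expansion is [- B] times the Taylor remainder, and [mu B] is bounded as above.

The matrix norm [mu] and the vector norm [nu] are not assumed compatible.  The
estimates are therefore made in the norm [column_norm mu], for which
[|A v| <= mu A |v|], and carried over to [nu] by the equivalence of norms in
finite dimension ([is_norm_upper], [is_norm_lower]). *)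

(** * Norms in finite dimension *)

Section NormTheory.
Context {R : realType} {V : lmodType R} {nu : V -> R} (nuP : is_norm nu).

Lemma is_normN v : nu (- v) = nu v.
Proof. by have [_ nuZ _] := nuP; rewrite -scaleN1r nuZ normrN1 mul1r. Qed.

Lemma is_norm_ge0 v : 0 <= nu v.
Proof.
have [_ nuZ nuD] := nuP.
have nu0 : nu 0 = 0 by rewrite -(scale0r 0) nuZ normr0 mul0r.
by have := nuD v (- v); rewrite subrr nu0 is_normN -mulr2n pmulrn_lge0.
Qed.

Lemma is_norm_sum (I : finType) (F : I -> V) :
  nu (\sum_i F i) <= \sum_i nu (F i).
Proof.
have [_ nuZ nuD] := nuP.
elim/big_ind2 : _ => [|u a v b ua vb|//].
  by rewrite -(scale0r 0) nuZ normr0 mul0r.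
by rewrite (le_trans (nuD _ _))// lerD.
Qed.

Lemma is_norm_dist u v : `|nu u - nu v| <= nu (u - v).
Proof.
have [_ _ nuD] := nuP.
rewrite ler_norml; apply/andP; split.
  by rewrite lerNl opprB lerBlDr -(is_normN (u - v)) opprB -{1}(subrK u v) nuD.
by rewrite lerBlDr -{1}(subrK v u) nuD.
Qed.

End NormTheory.

Lemma mx_entry_le_norm {R : realType} m n (A : 'M[R]_(m, n)) i j :
  `|A i j| <= `|A|.
Proof.
by rewrite [leRHS]/Num.Def.normr/= mx_normrE; exact: (le_bigmax _ _ (i, j)).
Qed.

Lemma mx_norm_le {R : realType} m n (A : 'M[R]_(m, n)) c :
  0 <= c -> (forall i j, `|A i j| <= c) -> `|A| <= c.
Proof.
by move=> c0 Ac; rewrite /Num.Def.normr/= mx_normrE bigmax_le.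
Qed.

Lemma is_norm_upper {R : realType} m n (nu : 'M[R]_(m, n) -> R) :
  is_norm nu -> exists2 c, 0 < c & forall v, nu v <= c * `|v|.
Proof.
move=> nuP; have [_ nuZ _] := nuP.
exists (1 + \sum_i \sum_j nu (delta_mx i j)).
  by rewrite ltr_pwDl// sumr_ge0// => i _; rewrite sumr_ge0// => j _;
    exact: is_norm_ge0.
move=> v; rewrite mulrDl mul1r -[leLHS]add0r lerD// mulr_suml.
rewrite {1}(matrix_sum_delta v) (le_trans (is_norm_sum nuP _))// ler_sum// => i _.
rewrite mulr_suml (le_trans (is_norm_sum nuP _))// ler_sum// => j _.
by rewrite nuZ mulrC ler_wpM2l ?is_norm_ge0// mx_entry_le_norm.
Qed.

Lemma is_norm_continuous {R : realType} m n (nu : 'M[R]_(m, n) -> R) :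
  is_norm nu -> continuous nu.
Proof.
move=> nuP x; have [c c0 nuc] := is_norm_upper nuP.
have FF : Filter (nbhs x) by exact: nbhs_filter.
apply/cvgrPdist_lt => e e0; apply/(nbhs_normP x).
exists (e / c) => /=; first by rewrite divr_gt0.
move=> y xy; rewrite (le_lt_trans (is_norm_dist nuP _ _))//.
by rewrite (le_lt_trans (nuc _))// mulrC -ltr_pdivlMr.
Qed.

(** A continuous positive function has a positive minimum on the unit sphere,
which is compact; homogeneity extends the bound to all vectors. *)
Lemma is_norm_lower_rV {R : realType} n (nu : 'rV[R]_n -> R) :
  is_norm nu -> exists2 c, 0 < c & forall v, `|v| <= c * nu v.
Proof.
move=> nuP; have [nu0 nuZ _] := nuP.
pose S := [set v : 'rV[R]_n | `|v| = 1].
have [[u Su]|S0] := pselect (S !=set0); last first.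
  (* In dimension 0 the sphere is empty and every vector is 0. *)
  exists 1 => // v; have [->|v0] := eqVneq v 0.
    by rewrite normr0 mulr_ge0// is_norm_ge0.
  exfalso; apply: S0; exists (`|v|^-1 *: v); rewrite /S/= normrZ normfV normr_id.
  by rewrite mulVf// normr_eq0.
have cS : compact S.
  apply: bounded_closed_compact.
    by exists 1; split => // M M1 v /= ->; exact: ltW.
  rewrite (_ : S = (fun v => `|v|) @^-1` [set 1])//.
  by apply: preimage_closed => [v _|]; [exact: norm_continuous|exact: closed_eq].
have nuS : {within S, continuous nu}.
  exact/continuous_subspaceT/is_norm_continuous.
have [w wS minw] := EVT_min_rV (ex_intro _ u Su) cS nuS.
have w0 : 0 < nu w.
  rewrite lt_def is_norm_ge0// andbT; apply/eqP => /nu0 w0.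
  by move: wS; rewrite inE /S/= w0 normr0 => /esym/eqP; rewrite oner_eq0.
exists (nu w)^-1; rewrite ?invr_gt0// => v.
have [->|v0] := eqVneq v 0; first by rewrite normr0 mulr_ge0 ?invr_ge0 ?is_norm_ge0.
have nv0 : 0 < `|v| by rewrite normr_gt0.
rewrite ler_pdivlMl// -ler_pdivlMr// [leRHS]mulrC.
rewrite -[X in _ <= X * _]ger0_norm ?invr_ge0// -nuZ.
apply: minw; rewrite inE /S/= normrZ normfV normr_id.
by rewrite mulVf// normr_eq0.
Qed.

Lemma mx_norm_trmx {R : realType} m n (A : 'M[R]_(m, n)) : `|A^T| = `|A|.
Proof.
apply/eqP; rewrite eq_le; apply/andP; split; apply: mx_norm_le => // i j.
  by rewrite mxE mx_entry_le_norm.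
by rewrite -(trmxK A) [_^T^T i j]mxE trmxK mx_entry_le_norm.
Qed.

Lemma is_norm_lower {R : realType} n (nu : 'cV[R]_n -> R) :
  is_norm nu -> exists2 c, 0 < c & forall v, `|v| <= c * nu v.
Proof.
move=> [nu0 nuZ nuD].
have [|c c0 cnu] := @is_norm_lower_rV R n (nu \o trmx).
  split => [v /nu0 v0|a v|u v] /=.
  - by apply: trmx_inj; rewrite v0 trmx0.
  - by rewrite linearZ nuZ.
  - by rewrite linearD nuD.
by exists c => // v; rewrite -mx_norm_trmx (le_trans (cnu _))//= trmxK.
Qed.

(** Repeating [v] in every column embeds vectors into matrices compatibly with
left multiplication, so submultiplicativity of [mu] makes this norm compatible
with [mu]. *)
Definition column_norm {R : realType} n (mu : 'M[R]_n -> R) (v : 'cV[R]_n) : R :=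
  mu (v *m const_mx 1).

Lemma column_norm_is_norm {R : realType} n (mu : 'M[R]_n -> R) :
  is_norm mu -> is_norm (column_norm mu).
Proof.
rewrite /column_norm; move=> [mu0 muZ muD]; split => [v /mu0/matrixP v0|a v|u v].
- apply/colP => i; have := v0 i i.
  by rewrite !mxE big_ord1 mxE mulr1.
- by rewrite -scalemxAl muZ.
- by rewrite mulmxDl muD.
Qed.

Lemma column_norm_mulmx {R : realType} n (mu : 'M[R]_n -> R) A v :
  is_matrix_norm mu -> column_norm mu (A *m v) <= mu A * column_norm mu v.
Proof. by case=> _ muM; rewrite /column_norm -mulmxA muM. Qed.

(** Neighbourhoods may be measured with any norm: this turns the local
estimates into a radius [delta] for the given norm. *)
Lemma near_is_norm {R : realType} n (nu : 'cV[R]_n -> R) (a : 'cV[R]_n)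
    (P : 'cV[R]_n -> Prop) :
  is_norm nu -> (\forall x \near a, P x) ->
  exists2 delta, 0 < delta & forall x, nu (a - x) < delta -> P x.
Proof.
move=> /is_norm_lower[c c0 cnu] /(nbhs_normP a)[d /= d0 dP].
exists (d / c); first by rewrite divr_gt0.
move=> x xd; apply: dP => /=; rewrite (le_lt_trans (cnu _))//.
by rewrite mulrC -ltr_pdivlMr.
Qed.

(** * Bounding the inverse of the preconditioner *)

(** From [B J0 = B J - B (J - J0)], the matrix [B] is the sum of [B J J0^-1],
bounded since [B J] is at distance at most 1 from the identity, and of a term of
norm at most [mu B / 2], which the left-hand side absorbs. *)
Lemma invertible_factor_bound {R : realType} n (mu : 'M[R]_n -> R)
    (B J J0 : 'M[R]_n) :
  is_matrix_norm mu -> J0 \in unitmx ->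
  mu (J - J0) * mu (invmx J0) <= 2^-1 -> mu (1%:M - B *m J) <= 1 ->
  mu B <= 2 * (mu 1%:M + 1) * mu (invmx J0).
Proof.
move=> [muP muM] uJ0 small BJ1; have [_ _ muD] := muP.
have BE : B = (1%:M - (1%:M - B *m J)) *m invmx J0 - B *m ((J - J0) *m invmx J0).
  by rewrite subKr mulmxBl mulmxV// mulmxBr mulmx1 mulmxA opprB addrC subrK.
have : mu B <= (mu 1%:M + 1) * mu (invmx J0) + mu B * 2^-1.
  rewrite {1}BE (le_trans (muD _ _))// is_normN// lerD//.
    rewrite (le_trans (muM _ _))// ler_wpM2r ?is_norm_ge0//.
    by rewrite (le_trans (muD _ _))// is_normN// lerD.
  rewrite (le_trans (muM _ _))// ler_wpM2l ?is_norm_ge0//.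
  by rewrite (le_trans (muM _ _)).
by lra.
Qed.

Lemma near_solution_inverse_bound {R : realType} n (mu : 'M[R]_n -> R)
    (J : 'cV[R]_n -> 'M[R]_n) (a : 'cV[R]_n) :
  is_matrix_norm mu -> {for a, continuous J} ->
  \forall x \near a, J a \in unitmx -> forall B, mu (1%:M - B *m J x) <= 1 ->
    mu B <= 2 * (mu 1%:M + 1) * mu (invmx (J a)).
Proof.
move=> muP cJ; have [mun _] := muP; have [m m0 mum] := is_norm_upper mun.
set i := mu (invmx (J a)); have i0 : 0 <= i by exact: is_norm_ge0.
have : \forall x \near a, `|J a - J x| < (2 * m * (i + 1))^-1.
  by move/cvgrPdist_lt : cJ; apply; rewrite invr_gt0 !mulr_gt0// ltr_wpDl.
apply: filterS => x Jx uJ B BJ.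
apply: (invertible_factor_bound (J := J x)) => //; rewrite -/i.
have i1 : 0 < i + 1 by rewrite ltr_wpDl.
rewrite (@le_trans _ _ (m * (2 * m * (i + 1))^-1 * (i + 1)))//.
  rewrite ler_pM ?is_norm_ge0// ?lerDl// (le_trans (mum _))//.
  by rewrite ler_wpM2l ?ltW// distrC.
by rewrite le_eqVlt; apply/orP; left; apply/eqP; field; rewrite !gt_eqF.
Qed.

(** * Taylor expansion to first and second order *)

Lemma derive_partial {R : realType} n (F : 'cV[R]_n -> R) (y e : 'cV[R]_n) :
  differentiable F y -> 'D_e F y = \sum_j e j 0 * partial j F y.
Proof.
move=> dF; rewrite deriveE// {1}(matrix_sum_delta e) linear_sum.
apply: eq_bigr => j _; rewrite big_ord1 linearZ /partial deriveE//.
Qed.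

Lemma differentiable_component {R : realType} n (f : 'cV[R]_n -> 'cV[R]_n) i x :
  differentiable f x -> differentiable (component f i) x.
Proof.
move=> df; apply: (@differentiable_comp _ _ _ _ f (fun v : 'cV[R]_n => v i 0)) => //.
exact: differentiable_coord.
Qed.

Lemma jacobian_mxE {R : realType} n (f : 'cV[R]_n -> 'cV[R]_n) x e :
  differentiable f x -> 'd f x e = jacobian_mx f x *m e.
Proof.
move=> df; rewrite -deriveE// derive_mx; last exact: diff_derivable.
apply/colP => i; rewrite !mxE.
transitivity ('D_e (component f i) x); first by [].
rewrite derive_partial; last exact: differentiable_component.
by apply: eq_bigr => j _; rewrite mxE mulrC.
Qed.

(** The expansion is centred at [a] but uses the Jacobian at [x].  Continuity
of the Jacobian at [a] makes this change cost only a small multiple of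
[nu (a - x)]. *)
Lemma linearization_error {R : realType} n (f : 'cV[R]_n -> 'cV[R]_n) a
    (nu : 'cV[R]_n -> R) (mu : 'M[R]_n -> R) (eps : R) :
  is_norm nu -> is_norm mu -> (forall A v, nu (A *m v) <= mu A * nu v) ->
  f a = 0 -> differentiable f a -> {for a, continuous (jacobian_mx f)} ->
  0 < eps ->
  \forall x \near a, nu (f x + jacobian_mx f x *m (a - x)) <= eps * nu (a - x).
Proof.
move=> nuP muP nuM fa0 df cJ eps0; have [_ _ nuD] := nuP.
have [b b0 nub] := is_norm_upper nuP; have [c c0 cnu] := is_norm_lower nuP.
have [m m0 mum] := is_norm_upper muP.
have small1 : \forall x \near a,
    `|f x - jacobian_mx f a *m (x - a)| <= eps / 2 / (b * c) * `|x - a|.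
  case: (df) => -[_ /eqaddoP]; rewrite lim_id; last exact: norm_hausdorff.
  have e0 : 0 < eps / 2 / (b * c) by rewrite !divr_gt0// mulr_gt0.
  move=> /(_ _ e0); apply: filterS => x /=.
  rewrite -jacobian_mxE//.
  by rewrite -[X in `|X| <= _ -> _]/(f x - (f a + 'd f a (x - a))) fa0 add0r.
have small2 : \forall x \near a,
    `|jacobian_mx f a - jacobian_mx f x| < eps / 2 / m.
  by move/cvgrPdist_lt : cJ; apply; rewrite !divr_gt0.
move: small1 small2; apply: filterS2 => x h1 h2.
have -> : f x + jacobian_mx f x *m (a - x) = (f x - jacobian_mx f a *m (x - a))
    - (jacobian_mx f a - jacobian_mx f x) *m (a - x).
  by rewrite mulmxBl -(opprB a x) mulmxN opprK opprB addrACA subrr addr0.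
rewrite (le_trans (nuD _ _))// is_normN// [eps]splitr mulrDl lerD//.
  rewrite (le_trans (nub _))// mulrC -ler_pdivlMr// (le_trans h1)//.
  rewrite -(normrN (x - a)) opprB invfM mulrA.
  have /(ler_wpM2l (ltW (divr_gt0 eps0 (ltr0Sn R 1)))) := cnu (a - x).
  move=> /(ler_wpM2r (ltW (divr_gt0 (divr_gt0 ltr01 b0) c0))).
  by congr (_ <= _); field; rewrite !gt_eqF.
rewrite (le_trans (nuM _ _))// ler_wpM2r ?is_norm_ge0//.
by rewrite (le_trans (mum _))// mulrC -ler_pdivlMr// ltW.
Qed.

(** The mean value theorem, used twice, bounds the remainder by the oscillation
of a possibly discontinuous [ddg]. *)
Lemma second_order_remainder {R : realType} (g dg ddg : R -> R) (K : R) :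
  (forall t : R, is_derive t 1 g (dg t)) ->
  (forall t : R, is_derive t 1 dg (ddg t)) ->
  (forall t, 0 <= t <= 1 -> `|ddg t - ddg 0| <= K) ->
  `|g 1 - g 0 - dg 0 - ddg 0 / 2| <= K.
Proof.
move=> g' dg' ddgK.
have K0 : 0 <= K by rewrite (le_trans _ (ddgK 0 _))// lexx ler01.
(* Up to the constant [g 0], [h] is the Taylor remainder as a function of the
   endpoint; [k] is its derivative and vanishes at 0. *)
pose h : R -> R := g - dg 0 *: id - (ddg 0 / 2) *: id ^+ 2.
pose k : R -> R := dg - cst (dg 0) - ddg 0 *: id.
have ht t : h t = g t - dg 0 * t - ddg 0 / 2 * t ^+ 2 by [].
have kt t : k t = dg t - dg 0 - ddg 0 * t by [].
have h' (t : R) : is_derive t 1 h (k t).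
  by apply: is_derive_eq; rewrite kt /GRing.scale/= !mulr1; field.
have k' (t : R) : is_derive t 1 k (ddg t - ddg 0).
  by apply: is_derive_eq; rewrite /GRing.scale/= subr0 mulr1.
have cts (u du : R -> R) (a b : R) : (forall t : R, is_derive t 1 u (du t)) ->
    {within `[a, b], continuous u}.
  move=> u'; apply/continuous_subspaceT => t.
  by apply/differentiable_continuous/derivable1_diffP; case: (u' t).
have [s s01 hE] := MVT ltr01 (fun t _ => h' t) (cts _ _ 0 1 h').
move: s01; rewrite in_itv/= => /andP[s0 s1].
have [u u0s kE] := MVT s0 (fun t _ => k' t) (cts _ _ 0 s k').
move: u0s; rewrite in_itv/= => /andP[u0 us].
have -> : g 1 - g 0 - dg 0 - ddg 0 / 2 = h 1 - h 0 by rewrite !ht; ring.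
rewrite hE subr0 mulr1 -[X in `|X|]subr0.
rewrite -[X in _ - X](_ : k 0 = 0); last by rewrite kt; ring.
rewrite kE subr0 normrM -[leRHS]mulr1 ler_pM//.
  by apply: ddgK; rewrite (ltW u0) (ltW (lt_trans us s1)).
by rewrite ger0_norm ltW.
Qed.

(** Both derivatives are limits of the same difference quotient. *)
Lemma is_derive_line {R : realType} (V : normedModType R) (F : V -> R) (x e : V)
    (t : R) : derivable F (t *: e + x) e ->
  is_derive t (1 : R) (fun s => F (s *: e + x)) ('D_e F (t *: e + x)).
Proof.
move=> dF.
have quotE : (fun h : R => h^-1 *: (F ((h *: 1 + t) *: e + x) - F (t *: e + x)))
    = (fun h => h^-1 *: (F (h *: e + (t *: e + x)) - F (t *: e + x))).
  by apply/funext => h; rewrite [h *: 1]mulr1 scalerDl addrA.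
by split; [rewrite /derivable quotE|rewrite /derive quotE].
Qed.

Lemma quadratic_form_bound {R : realType} n (H : 'M[R]_n) (e : 'cV[R]_n) :
  `|(e^T *m H *m e) 0 0| <= n%:R ^+ 2 * `|H| * `|e| ^+ 2.
Proof.
rewrite mxE (le_trans (ler_norm_sum _ _ _))//.
rewrite (@le_trans _ _ (\sum_(j < n) n%:R * `|H| * `|e| ^+ 2))//; last first.
  by rewrite sumr_const card_ord -[leLHS]mulr_natl (expr2 n%:R) !mulrA.
apply: ler_sum => j _; rewrite normrM expr2 mulrA ler_pM// ?mx_entry_le_norm//.
rewrite mxE (le_trans (ler_norm_sum _ _ _))//.
rewrite (@le_trans _ _ (\sum_(i < n) `|H| * `|e|))//; last first.
  by rewrite sumr_const card_ord -[leLHS]mulr_natl mulrA.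
apply: ler_sum => i _; rewrite normrM mulrC mxE.
by rewrite ler_pM// mx_entry_le_norm.
Qed.

(** The directional derivative of [J(z) e] along [e] is the Hessian form.  It
is the second derivative of the component [i] of [f] on a line of direction
[e]. *)
Lemma second_derivative_line {R : realType} n (f : 'cV[R]_n -> 'cV[R]_n)
    (i : 'I_n) (e y : 'cV[R]_n) :
  differentiable (jacobian_mx f) y ->
  derivable (fun z => (jacobian_mx f z *m e) i 0) y e /\
  'D_e (fun z => (jacobian_mx f z *m e) i 0) y = hessian_forms f y e i 0.
Proof.
move=> dJ.
have dJil l : differentiable (partial l (component f i)) y.
  rewrite (_ : partial l _ = fun z => jacobian_mx f z i l).
    apply: (@differentiable_comp _ _ _ _ (jacobian_mx f)
      (fun A : 'M[R]_n => A i l)) => //.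
    exact: differentiable_coord.
  by apply/funext => z; rewrite mxE.
have -> : (fun z => (jacobian_mx f z *m e) i 0)
    = \sum_l (e l 0 *: partial l (component f i)).
  apply/funext => z; rewrite fct_sumE mxE; apply: eq_bigr => l _.
  by rewrite mxE mulrC.
have dl l : derivable (e l 0 *: partial l (component f i)) y e.
  by apply: derivableZ; exact: diff_derivable.
split; first exact: derivable_sum.
rewrite derive_sum// /hessian_forms !mxE; apply: eq_bigr => l _.
rewrite deriveZ; last exact: diff_derivable.
rewrite derive_partial// mxE [LHS]mulrC; congr (_ * _).
by apply: eq_bigr => j _; rewrite !mxE.
Qed.

(** [second_order_remainder] for the restriction of the component [i] of [f] to
the segment from [x] to [x + e]. *)
Lemma component_taylor {R : realType} n (f : 'cV[R]_n -> 'cV[R]_n)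
    (i : 'I_n) (x e : 'cV[R]_n) (K : R) :
  twice_differentiable f ->
  (forall t, 0 <= t <= 1 ->
    `|hessian_forms f (t *: e + x) e i 0 - hessian_forms f x e i 0| <= K) ->
  `|(f (x + e) - f x - jacobian_mx f x *m e - 2^-1 *: hessian_forms f x e) i 0|
    <= K.
Proof.
move=> [df dJ] HK.
pose g t := component f i (t *: e + x).
pose dg t : R := (jacobian_mx f (t *: e + x) *m e) i 0.
pose ddg t : R := hessian_forms f (t *: e + x) e i 0.
have g' (t : R) : is_derive t 1 g (dg t).
  have dfi := differentiable_component i (df (t *: e + x)).
  have := is_derive_line (diff_derivable (v := e) dfi); rewrite derive_partial//.
  rewrite (_ : \sum_j _ = dg t)// /dg mxE.
  by apply: eq_bigr => j _; rewrite !mxE mulrC.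
have dg' (t : R) : is_derive t 1 dg (ddg t).
  have [d dE] := second_derivative_line i e (dJ (t *: e + x)).
  by rewrite /ddg -dE; exact: is_derive_line d.
have := second_order_remainder g' dg' (K := K).
rewrite /g /dg /ddg scale0r add0r scale1r (addrC e) => /(_ HK).
by rewrite /component !mxE [_ / 2]mulrC.
Qed.

Lemma hessian_forms_dist {R : realType} n (f : 'cV[R]_n -> 'cV[R]_n)
    (z x e : 'cV[R]_n) (i : 'I_n) :
  `|hessian_forms f z e i 0 - hessian_forms f x e i 0|
    <= n%:R ^+ 2 * `|hessian_mx (component f i) z - hessian_mx (component f i) x|
       * `|e| ^+ 2.
Proof.
have formE y : hessian_forms f y e i 0
    = (e^T *m hessian_mx (component f i) y *m e) 0 0 by rewrite mxE.
have entryB (A B : 'M[R]_1) : A 0 0 - B 0 0 = (A - B) 0 0 by rewrite !mxE.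
rewrite (f_equal2 (fun u v => u - v) (formE z) (formE x)) entryB.
rewrite -(mulmxBl (e^T *m _)) -(mulmxBr e^T).
exact: quadratic_form_bound.
Qed.

(** Every point [z] of the segment from [x] to [a] is at least as close to [a]
as [x] is, so the Hessians at [z] and at [x] both differ from the one at [a] by
at most [k |a - x|].  The Hessian form is quadratic in [a - x], which gives the
third order. *)
Lemma taylor_remainder_cubic {R : realType} n (f : 'cV[R]_n -> 'cV[R]_n)
    (a : 'cV[R]_n) :
  twice_differentiable f -> hessians_lipschitz_at f a ->
  exists2 C : R, 0 <= C & \forall x \near a,
    `|f a - f x - jacobian_mx f x *m (a - x)
      - 2^-1 *: hessian_forms f x (a - x)| <= C * `|a - x| ^+ 3.
Proof.
move=> f2 Hlip.
pose rem x := f a - f x - jacobian_mx f x *m (a - x)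
  - 2^-1 *: hessian_forms f x (a - x).
have /choice[C CP] : forall i, exists c : R, 0 <= c /\
    \forall x \near a, `|rem x i 0| <= c * `|a - x| ^+ 3.
  move=> i.
  have /eqO_exP[k k0 /(nbhs_normP a)[d /= d0 kP]] := Hlip i.
  exists (n%:R ^+ 2 * (k + k)).
  split; first by rewrite mulr_ge0 ?exprn_ge0// addr_ge0// ltW.
  apply/(nbhs_normP a); exists d => //= x xd; set e := a - x.
  rewrite /rem -/e -[in f a](subrK x a) -/e (addrC e).
  apply: component_taylor => // t /andP[t0 t1].
  rewrite (le_trans (hessian_forms_dist _ _ _ _ _))//.
  rewrite -mulrA -[leRHS]mulrA; apply: ler_wpM2l; first exact: exprn_ge0.
  rewrite (exprS _ 2) [leRHS]mulrA ler_wpM2r ?exprn_ge0//.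
  have Hz z : `|z - a| <= `|e| ->
      `|hessian_mx (component f i) z - hessian_mx (component f i) a|
        <= k * `|e|.
    move=> ze; rewrite (le_trans (kP z _))//=.
      by rewrite distrC (le_lt_trans ze).
    by rewrite ler_wpM2l// ltW.
  rewrite -(subrKA (hessian_mx (component f i) a)) (le_trans (ler_normD _ _))//.
  rewrite mulrDl lerD//.
    apply: Hz; rewrite (_ : _ - a = (t - 1) *: e).
      rewrite normrZ ler_piMl// ler_norml; apply/andP; split; lra.
    by rewrite scalerBl scale1r /e opprB addrA.
  by rewrite distrC Hz// distrC.
exists (\sum_i C i); first by rewrite sumr_ge0// => i _; case: (CP i).
have : \forall x \near a, forall i, `|rem x i 0| <= C i * `|a - x| ^+ 3.
  by apply: (@filter_forall _ _ _ _ (nbhs_filter a)) => i; case: (CP i).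
apply: filterS => x remx; rewrite -/(rem x).
have C0 i : 0 <= C i by case: (CP i).
apply: mx_norm_le => [|i j]; first by rewrite mulr_ge0 ?sumr_ge0 ?exprn_ge0.
rewrite ord1 (le_trans (remx i))// ler_wpM2r ?exprn_ge0//.
by rewrite (bigD1 i)//= lerDl sumr_ge0.
Qed.

(** * Local behaviour of the iteration *)

Lemma error_step {R : realType} n (B J : 'M[R]_n) (a x v : 'cV[R]_n) :
  a - (x - B *m v) = (1%:M - B *m J) *m (a - x) + B *m (v + J *m (a - x)).
Proof.
rewrite mulmxBl mul1mx (mulmxDr B) mulmxA [B *m v + _]addrC addrA subrK.
by rewrite opprB addrA addrAC.
Qed.

(** Half of the gap between [rho] and 1 is spent on the linearization error,
amplified by the bound [K] on [mu B]. *)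
Lemma local_contraction {R : realType} n (nu : 'cV[R]_n -> R)
    (mu : 'M[R]_n -> R) (f : 'cV[R]_n -> 'cV[R]_n) (a : 'cV[R]_n) (rho : R) :
  is_norm nu -> is_matrix_norm mu ->
  (forall A v, nu (A *m v) <= mu A * nu v) ->
  f a = 0 -> differentiable f a -> {for a, continuous (jacobian_mx f)} ->
  jacobian_mx f a \in unitmx -> 0 <= rho < 1 ->
  \forall x \near a, forall B,
    mu (1%:M - B *m jacobian_mx f x) <= rho ->
    nu (a - (x - B *m f x)) <= (rho + 1) / 2 * nu (a - x).
Proof.
move=> nuP muP nuM fa0 df cJ uJ /andP[rho0 rho1].
have [mun _] := muP; have [_ _ nuD] := nuP.
pose K := 2 * (mu 1%:M + 1) * mu (invmx (jacobian_mx f a)).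
have K0 : 0 <= K by rewrite !mulr_ge0 ?addr_ge0 ?is_norm_ge0.
have K1 : 0 < K + 1 by rewrite ltr_wpDl.
(* [K] may vanish, hence the division by [K + 1]. *)
pose eps := (1 - rho) / 2 / (K + 1).
have eps0 : 0 < eps by rewrite !divr_gt0// subr_gt0.
have Keps : K * eps <= (1 - rho) / 2.
  rewrite /eps mulrCA ler_piMr//; first by rewrite divr_ge0// subr_ge0 ltW.
  by rewrite ler_pdivrMr// mul1r lerDl.
have := linearization_error nuP mun nuM fa0 df cJ eps0.
have := near_solution_inverse_bound muP cJ.
apply: filterS2 => x invx linx B BJ.
have muB : mu B <= K by apply: invx => //; rewrite (le_trans BJ)// ltW.
rewrite (error_step B (jacobian_mx f x)) (le_trans (nuD _ _))//.
rewrite (_ : (rho + 1) / 2 = rho + (1 - rho) / 2); last by field.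
rewrite mulrDl lerD//.
  by rewrite (le_trans (nuM _ _))// ler_wpM2r ?is_norm_ge0.
rewrite (le_trans (nuM _ _))// (@le_trans _ _ (K * (eps * nu (a - x))))//.
  by rewrite ler_pM ?is_norm_ge0.
by rewrite mulrA ler_wpM2r ?is_norm_ge0.
Qed.

(** The contraction estimate is only available within distance [delta] of [a];
the decrease of the errors keeps all iterates there. *)
Lemma contraction_cvg {R : realType} n (nu : 'cV[R]_n -> R) (a : 'cV[R]_n)
    (x : nat -> 'cV[R]_n) (q delta : R) :
  is_norm nu -> 0 <= q < 1 -> nu (a - x 0%N) < delta ->
  (forall k, nu (a - x k) < delta -> nu (a - x k.+1) <= q * nu (a - x k)) ->
  x @ \oo --> a.
Proof.
move=> nuP /andP[q0 q1] x0 step.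
have geom k : nu (a - x k) < delta /\ nu (a - x k) <= nu (a - x 0%N) * q ^+ k.
  elim: k => [|k [kd kq]]; first by rewrite expr0 mulr1.
  have le_k := step k kd; split.
    by rewrite (le_lt_trans le_k)// (le_lt_trans _ kd)// ler_piMl ?is_norm_ge0// ltW.
  by rewrite (le_trans le_k)// exprS mulrCA ler_wpM2l.
have [c c0 cnu] := is_norm_lower nuP.
apply/cvgrPdist_le => e e0.
have : c * nu (a - x 0%N) * q ^+ k @[k --> \oo] --> c * nu (a - x 0%N) * 0.
  by apply: cvgMl_tmp; apply: cvg_expr; rewrite ger0_norm.
rewrite mulr0 => /cvgrPdist_le/(_ _ e0); apply: filterS => k.
rewrite sub0r normrN; apply: le_trans.
rewrite (le_trans (cnu _))// (le_trans _ (ler_norm _))// -mulrA.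
have [_ gk] := geom k. by apply: ler_wpM2l => //; exact: ltW.
Qed.

Theorem theorem1 (R : realType) (n : nat)
    (nu : 'cV[R]_n -> R) (mu : 'M[R]_n -> R)
    (f : 'cV[R]_n -> 'cV[R]_n) (xstar : 'cV[R]_n) :
  is_norm nu -> is_matrix_norm mu ->
  f xstar = 0 ->
  continuously_differentiable f -> twice_differentiable f ->
  (jacobian_mx f xstar \in unitmx ->
   forall rho : R, rho < 1 ->
   exists2 delta : R, 0 < delta &
     forall (M : nat -> 'M[R]_n) (x : nat -> 'cV[R]_n),
       (forall k, M k \in unitmx) ->
       preconditioned_iteration f M x ->
       nu (xstar - x 0%N) < delta ->
       (forall k, mu (1%:M - invmx (M k) *m jacobian_mx f (x k)) <= rho) ->
       x @ \oo --> xstar)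
  /\
  (hessians_lipschitz_at f xstar ->
   exists C : R, exists2 delta : R, 0 < delta &
     forall (M : nat -> 'M[R]_n) (x : nat -> 'cV[R]_n),
       (forall k, M k \in unitmx) ->
       preconditioned_iteration f M x ->
       let e := fun k => xstar - x k in
       let J := fun k => jacobian_mx f (x k) in
       exists r : nat -> 'cV[R]_n, forall k,
         e k.+1 = (1%:M - invmx (M k) *m J k) *m e k
                  - 2^-1 *: (invmx (M k) *m hessian_forms f (x k) (e k))
                  + r k
         /\ (nu (e k) < delta ->
              nu (r k) <= C * mu (invmx (M k)) * nu (e k) ^+ 3 /\
              (jacobian_mx f xstar \in unitmx ->
               mu (1%:M - invmx (M k) *m J k) < 1 ->
               nu (r k) <= C * nu (e k) ^+ 3))).
Proof.
move=> nuP muP fa0 [df cJ] f2.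
have [mun _] := muP.
pose N := column_norm mu.
have NP : is_norm N by exact: column_norm_is_norm.
have NM A v : N (A *m v) <= mu A * N v by exact: column_norm_mulmx.
have [c c0 cnu] := is_norm_lower nuP.
split=> [uJ rho rho1|Hlip].
  (* The bound [rho] may be negative, for instance in dimension 0. *)
- pose rho0 := Num.max rho 0.
  have rho01 : 0 <= rho0 < 1 by rewrite le_max lexx orbT gt_max rho1 ltr01.
  have step := local_contraction NP muP NM fa0 (df xstar) (cJ xstar) uJ rho01.
  have [delta delta0 deltaP] := near_is_norm NP step.
  have [d d0 Nd] := is_norm_upper NP.
  exists (delta / (d * c)); first by rewrite divr_gt0// mulr_gt0.
  move=> M x uM xit x0 BJ.
  apply: (@contraction_cvg _ _ N _ _ ((rho0 + 1) / 2) delta) => //.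
  + by move: rho01 => /andP[? ?]; apply/andP; split; lra.
  + rewrite (le_lt_trans (Nd _))// (@le_lt_trans _ _ (d * c * nu (xstar - x 0%N)))//.
      by rewrite -mulrA ler_pM2l.
    by rewrite mulrC -ltr_pdivlMr// mulr_gt0.
  + move=> k kd; rewrite xit; apply: deltaP => //.
    by rewrite le_max BJ.
have [C C0 remC] := taylor_remainder_cubic f2 Hlip.
have inv := near_solution_inverse_bound muP (cJ xstar).
have [delta delta0 deltaP] := near_is_norm nuP (filterI remC inv).
have [cN cN0 cNN] := is_norm_lower NP.
have [b b0 nub] := is_norm_upper nuP; have [d d0 Nd] := is_norm_upper NP.
pose K := 2 * (mu 1%:M + 1) * mu (invmx (jacobian_mx f xstar)).
have K0 : 0 <= K by rewrite !mulr_ge0 ?addr_ge0 ?is_norm_ge0.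
(* [b], [cN], [d] and [c] come from passing from [nu] to the norm [N] and back. *)
pose C1 := b * cN * d * C * c ^+ 3.
have C10 : 0 <= C1 by rewrite !mulr_ge0 ?exprn_ge0// ltW.
(* One constant for both estimates: [C1] serves the one in which [mu B] occurs,
   [C1 * K] the one in which it is replaced by its bound [K]. *)
exists (C1 * (K + 1)), delta => // M x uM xit e J.
pose rem k := f xstar - f (x k) - J k *m e k - 2^-1 *: hessian_forms f (x k) (e k).
exists (fun k => - (invmx (M k) *m rem k)) => k; split.
  have remE : f (x k) + J k *m e k
      = - (2^-1 *: hessian_forms f (x k) (e k) + rem k).
    by rewrite /rem fa0 sub0r addrCA subrr addr0 opprD !opprK.
  rewrite /e xit (error_step _ (J k)) -/(e k) remE mulmxN (mulmxDr (invmx _)) opprD addrA.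
  by rewrite -scalemxAr.
move=> ek; have [remk invk] := deltaP (x k) ek.
have rk : nu (- (invmx (M k) *m rem k)) <= C1 * mu (invmx (M k)) * nu (e k) ^+ 3.
  rewrite is_normN// (le_trans (nub _))// /C1.
  have -> : b * cN * d * C * c ^+ 3 * mu (invmx (M k)) * nu (e k) ^+ 3
      = b * (cN * (mu (invmx (M k)) * (d * (C * (c * nu (e k)) ^+ 3)))) by ring.
  rewrite ler_pM2l// (le_trans (cNN _))// ler_pM2l// (le_trans (NM _ _))//.
  rewrite ler_wpM2l ?is_norm_ge0// (le_trans (Nd _))// ler_pM2l//.
  rewrite (le_trans remk)// ler_wpM2l// lerXn2r ?nnegrE//.
  by rewrite mulr_ge0 ?is_norm_ge0// ltW.
have e3 : 0 <= nu (e k) ^+ 3 by rewrite exprn_ge0// is_norm_ge0.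
split=> [|uJ BJ].
  rewrite (le_trans rk)// ler_wpM2r// ler_wpM2r ?is_norm_ge0//.
  by rewrite ler_peMr// lerDr.
rewrite (le_trans rk)// ler_wpM2r// ler_wpM2l//.
rewrite (@le_trans _ _ K)// ?lerDl//.
by apply: invk => //; exact: ltW.
Qed.
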